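(* Let $V$ be a vector space over a field, let $W$ be a subspace of $V$, and let $\mathbb{S}(W)$ be a subsemigroup of $L(W)$. Then $L_{\mathbb{S}(W)}(V)$ is a completely regular semigroup if and only if $\mathbb{S}(W)$ is a completely regular semigroup and one of the following holds: (i) $W=V$; (ii) $\mathrm{codim}(W)=1$ and $\mathbb{S}(W)$ is a subgroup of $\mathrm{Aut}(W)$.
   Context: Semigroups (hence subsemigroups) are nonempty. For a vector space $U$, $L(U)$ is the semigroup of all linear maps $U\to U$ under composition (composed from left to right, with $vf$ denoting the image of $v$ under $f$), and $\mathrm{Aut}(U)$ is the group of all linear automorphisms of $U$. For $f\in L(V)$ with $Wf\subseteq W$, $f_{\upharpoonright_W}\in L(W)$ denotes the linear map $W\to W$ that agrees with $f$ on $W$. Define $L_{\mathbb{S}(W)}(V)=\{f\in L(V) : Wf\subseteq W \text{ and } f_{\upharpoonright_W}\in\mathbb{S}(W)\}$, a subsemigroup of $L(V)$. $\mathrm{codim}(W)=\dim(V/W)$. A semigroup $S$ is completely regular if every element of $S$ belongs to some subgroup of $S$, where a subgroup of a semigroup $S$ is a subsemigroup of $S$ that is a group under the operation of $S$ (with its own identity element, an idempotent of $S$). *)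

(* Defs.v *)
From HB Require Import structures.
From mathcomp Require Import all_boot all_order all_algebra.
From mathcomp Require Import boolp classical_sets.

Set Implicit Arguments.
Unset Strict Implicit.
Unset Printing Implicit Defensive.

Import GRing.Theory.
Local Open Scope ring_scope.
Local Open Scope quotient_scope.
Local Open Scope classical_set_scope.

Section Semigroups.
Variable T : semigroupType.
Implicit Types A G : set T.
Local Open Scope group_scope.

Definition subsemigroup A : Prop :=
  A !=set0 /\ forall x y, A x -> A y -> A (x * y).

(* [G] is a group under the operation of [T]; its identity is an idempotent of
   [T], not a distinguished unit of [T]. *)
Definition group_under_mul G : Prop :=
  subsemigroup G /\
  exists2 e, G e &
    (forall x, G x -> e * x = x /\ x * e = x) /\
    (forall x, G x -> exists2 y, G y & x * y = e /\ y * x = e).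

Definition subgroup_of G A : Prop := G `<=` A /\ group_under_mul G.

Definition completely_regular_semigroup A : Prop :=
  subsemigroup A /\ forall x, A x -> exists2 G, subgroup_of G A & G x.

End Semigroups.

Section LinearMaps.
Variables (F : fieldType) (U : lmodType F).

Definition linmap := {linear U -> U}.

HB.instance Definition _ := gen_eqMixin linmap.
HB.instance Definition _ := gen_choiceMixin linmap.

Lemma linmap_ext (f g : linmap) : f =1 g -> f = g.
Proof.
case: f g => [f [[f1] [f2]]] [g [[g1] [g2]]] /= /funext fg.
by subst g; congr (GRing.Linear.Pack (GRing.Linear.Class _ _)); congr (_ _);
  exact: Prop_irrelevance.
Qed.

(* Maps are composed from left to right. *)
Definition linmap_mul (f g : linmap) : linmap := (g : {linear U -> U}) \o f.

Lemma linmap_mulA : associative linmap_mul.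
Proof. by move=> f g h; exact: linmap_ext. Qed.

HB.instance Definition _ := isSemigroup.Build linmap linmap_mulA.

Definition linAut : set linmap := [set f | bijective f].

Definition has_dim (n : nat) : Prop :=
  exists b : 'I_n -> U,
    (forall c : 'I_n -> F, \sum_i c i *: b i = 0 -> forall i, c i = 0) /\
    (forall u : U, exists c : 'I_n -> F, u = \sum_i c i *: b i).

End LinearMaps.

Arguments linAut {F} U.

Section Subspaces.
Variables (F : fieldType) (V : lmodType F) (W : submodClosed V).

(* Boolean subspaces are no restriction: by boolp every predicate is decidable. *)
Definition subspace := {x : V | x \in W}.

HB.instance Definition _ := SubChoice.on subspace.
HB.instance Definition _ := [SubChoice_isSubLmodule of subspace by <:].

Lemma subspace_zmod_closed : zmod_closed W.
Proof.
by split=> [|x y xW yW]; [exact: rpred0|rewrite -scaleN1r rpredD ?rpredZ].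
Qed.

Definition subspace_pred : {pred V} := W.
HB.instance Definition _ :=
  GRing.isZmodClosed.Build V subspace_pred subspace_zmod_closed.

Definition quotient := Quotient.quot subspace_pred.
HB.instance Definition _ := ZmodQuotient.on quotient.

Definition quotient_scale (a : F) (x : quotient) : quotient :=
  \pi_quotient (a *: repr x).

Lemma quotient_reprK (x : quotient) : \pi_quotient (repr x) = x.
Proof. exact: reprK. Qed.

Lemma pi_quotient_scale a (v : V) :
  quotient_scale a (\pi_quotient v) = \pi_quotient (a *: v).
Proof.
apply/eqP; rewrite -[_ == _]Quotient.idealrBE -scalerBr.
apply: (rpredZ (s := W)); change (repr (\pi_quotient v) - v \in subspace_pred).
by rewrite Quotient.idealrBE; apply/eqP; exact: quotient_reprK.
Qed.

Lemma pi_quotientD (v w : V) :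
  \pi_quotient v + \pi_quotient w = \pi_quotient (v + w).
Proof. by rewrite [RHS]Quotient.pi_add. Qed.

Lemma quotient_scalerA a b x :
  quotient_scale a (quotient_scale b x) = quotient_scale (a * b) x.
Proof. by rewrite -(quotient_reprK x) !pi_quotient_scale scalerA. Qed.

Lemma quotient_scale1r : left_id 1 quotient_scale.
Proof. by move=> x; rewrite -(quotient_reprK x) pi_quotient_scale scale1r. Qed.

Lemma quotient_scalerDr : right_distributive quotient_scale +%R.
Proof.
move=> a x y; rewrite -(quotient_reprK x) -(quotient_reprK y).
by rewrite pi_quotientD !pi_quotient_scale pi_quotientD scalerDr.
Qed.

Lemma quotient_scalerDl x : {morph quotient_scale^~ x : a b / a + b}.
Proof.
move=> a b; rewrite -(quotient_reprK x).
by rewrite !pi_quotient_scale pi_quotientD scalerDl.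
Qed.

HB.instance Definition _ := GRing.Zmodule_isLmodule.Build F quotient
  quotient_scalerA quotient_scale1r quotient_scalerDr quotient_scalerDl.

Definition codim_eq (n : nat) : Prop := has_dim quotient n.

Definition invariant (f : linmap V) : Prop := forall w, w \in W -> f w \in W.

Section Restriction.
Variables (f : linmap V) (fW : invariant f).

Definition restr_fun (w : subspace) : subspace := Sub (f (val w)) (fW (valP w)).

Lemma restr_fun_linear : linear restr_fun.
Proof. by move=> a x y; apply: val_inj; rewrite /= !linearP. Qed.

HB.instance Definition _ :=
  GRing.isLinear.Build F subspace subspace _ restr_fun restr_fun_linear.

Definition restr : linmap subspace := restr_fun.

End Restriction.

Definition lin_restr_in (S : set (linmap subspace)) : set (linmap V) :=
  [set f | exists fW : invariant f, S (restr fW)].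

End Subspaces.

(* Main.v *)
(* An element of a semigroup lies in a subgroup iff it has a commuting inner
   inverse in the semigroup.  A linear map [f] with such an inverse has the same
   kernel and the same image as its square.  If [W] is proper, every [s] in
   [S(W)] extends to [V] via a projection onto [W] (Zorn), and the extension may
   be perturbed by any rank one map vanishing on [W]: perturbing by a map with
   image in [W] forces [s] to be bijective, and a nilpotent perturbation rules
   out codimension at least 2.  Conversely, in codimension 1, an extension [f]
   of [s] in [Aut(W)] either maps [V] onto [W], and then [f] followed by the square
   of an extension of [s^-1] is a commuting inverse, or is an automorphism. *)
Require Import Defs.
From HB Require Import structures.
From mathcomp Require Import all_boot all_order all_algebra.
From mathcomp Require Import boolp classical_sets.

Set Implicit Arguments.
Unset Strict Implicit.
Unset Printing Implicit Defensive.

Import GRing.Theory.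

(** * Complete regularity through commuting inverses *)

Section CompletelyRegular.
Variable T : semigroupType.
Implicit Types S : set T.
Local Open Scope classical_set_scope.
Local Open Scope group_scope.

Lemma group_under_mul_commuting_inverse (G : set T) (x : T) :
  group_under_mul G -> G x -> exists2 y, G y & x * y = y * x /\ x * y * x = x.
Proof.
move=> [_ [e Ge [eG invG]]] Gx; have [y Gy [xy yx]] := invG _ Gx.
by exists y => //; rewrite xy yx; split=> //; case: (eG _ Gx).
Qed.

(* The subgroup attached to [x] is the group of units of the local monoid
   [e S e], where [e = x * y]. *)
Lemma completely_regularP S :
  completely_regular_semigroup S <->
  subsemigroup S /\
  forall x, S x -> exists2 y, S y & x * y = y * x /\ x * y * x = x.
Proof.
split=> -[Ssub crS]; split=> // x Sx.
  have [G [GS grpG] Gx] := crS x Sx.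
  have [y Gy xyP] := group_under_mul_commuting_inverse grpG Gx.
  by exists y => //; exact: GS.
have SM := Ssub.2; have [y Sy [xyC xyx]] := crS x Sx.
pose e := x * y; pose M := [set h | S h /\ e * h = h /\ h * e = h].
have Se : S e by exact: SM.
have ee : e * e = e by rewrite /e mulgA xyx.
have Me : M e by [].
have MM h k : M h -> M k -> M (h * k).
  move=> [Sh [eh he]] [Sk [ek ke]]; split; first exact: SM.
  by rewrite mulgA eh -mulgA ke.
have Mx : M x by split=> //; split; rewrite /e ?xyx // xyC mulgA xyx.
have ey : e * y = y * e by rewrite /e mulgA -xyC.
(* [y] need not lie in the local monoid; its cut-down [e * y] does, and is still inverse to [x]
   there. *)
pose z := e * y.
have Mz : M z.
  split; first exact: SM.
  by split; [rewrite /z (mulgA e) ee|rewrite /z ey -(mulgA y e e) ee].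
have xz : x * z = e by rewrite /z mulgA Mx.2.2.
have zx : z * x = e by rewrite /z -mulgA -xyC.
pose G := [set h | M h /\ exists2 k, M k & h * k = e /\ k * h = e].
exists G; last by split=> //; exists z.
split; first by move=> h [[]].
have Ge : G e by split=> //; exists e.
split.
  split; first by exists e.
  move=> h k [Mh [h' Mh' [hh' h'h]]] [Mk [k' Mk' [kk' k'k]]].
  split; first exact: MM.
  exists (k' * h'); first exact: MM.
  split.
    by rewrite -mulgA (mulgA k) kk' Mh'.2.1.
  by rewrite -mulgA (mulgA h') h'h Mk.2.1.
exists e => //; split; first by move=> h [[_ []]].
move=> h [Mh [k Mk [hk kh]]]; exists k => //.
by split=> //; exists h.
Qed.

End CompletelyRegular.

(** * Complements, projections and functionals in arbitrary dimension *)

Section Projections.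
Variables (F : fieldType) (V : lmodType F).
Implicit Types U : set V.
Local Open Scope classical_set_scope.
Local Open Scope ring_scope.

Definition linear_set U := forall a u v, U u -> U v -> U (a *: u + v).

Lemma exists_complement U : U 0 -> linear_set U ->
  exists C : set V, [/\ C 0, linear_set C, (forall v, C v -> U v -> v = 0) &
    forall v, exists2 u, U u & C (v - u)].
Proof.
move=> U0 Ulin.
(* [P] does not ask for 0, so the empty union of an empty chain satisfies it; maximality puts 0 in
   [C] afterwards. *)
pose P (C : set V) := linear_set C /\ forall v, C v -> U v -> v = 0.
have [K KP Ktot|C [[Clin CU] Cmax]] := @Zorn_bigcup V P.
  split=> [a u v [A KA Au] [B KB Bv]|v [A KA Av]]; last exact: (KP _ KA).2.
  by have [AB|BA] := Ktot _ _ KA KB;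
    [exists B => //; apply: (KP _ KB).1 => //; exact: AB
    |exists A => //; apply: (KP _ KA).1 => //; exact: BA].
have maxC B : P B -> C `<=` B -> B `<=` C.
  move=> PB CB; apply: contrapT => BC.
  by apply: (Cmax B) => //; split.
have C0 : C 0.
  have [[c Cc]|Cempty] := pselect (C !=set0).
    by have := Clin (-1) _ _ Cc Cc; rewrite scaleN1r addNr.
  apply: (maxC [set 0]) => //; last by move=> c Cc; case: Cempty; exists c.
  split=> [a u v -> ->|v -> //]; by rewrite scaler0 addr0.
exists C; split=> // v; apply: contrapT => vUC.
(* If [B], the span of [v] and [C], satisfies [P], maximality gives [C v], so [v] decomposes with
   [U]-part 0. *)
pose B := [set b | exists a, exists2 c, C c & b = a *: v + c].
have Bv : B v by exists 1, 0 => //; rewrite scale1r addr0.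
case: (vUC); exists 0; rewrite ?subr0 //.
apply: (maxC B) => //; last by move=> c Cc; exists 0, c; rewrite ?scale0r ?add0r.
split=> [a _ _ [b [c Cc ->]] [b' [c' Cc' ->]]|_ [a [c Cc ->]] Uac].
  exists (a * b + b'), (a *: c + c'); first exact: Clin.
  by rewrite scalerDr scalerDl scalerA addrACA.
(* For nonzero [a], solving for [v] in [a *: v + c] would decompose [v]. *)
have [a0|a0] := eqVneq a 0.
  by move: Uac; rewrite a0 scale0r add0r; exact: CU.
case: vUC; exists (a^-1 *: (a *: v + c)).
  by rewrite -[_ *: _]addr0; exact: Ulin.
rewrite scalerDr scalerA mulVf // scale1r opprD addNKr -scaleNr.
by rewrite -[_ *: _]addr0; exact: Clin.
Qed.

(** Choice picks the [U]-component along a complement; uniqueness of the decomposition makes it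
    linear. *)
Lemma exists_projection U : U 0 -> linear_set U ->
  exists p : {linear V -> V}, (forall v, U (p v)) /\ forall u, U u -> p u = u.
Proof.
move=> U0 Ulin.
have [C [C0 Clin CU decomp]] := exists_complement U0 Ulin.
have uniq_dec v u u' : U u -> C (v - u) -> U u' -> C (v - u') -> u = u'.
  move=> Uu Cu Uu' Cu'; apply/subr0_eq/CU.
    suff -> : u - u' = -1 *: (v - u) + (v - u') by exact: Clin.
    by rewrite scaleN1r opprB addrA subrK.
  by rewrite addrC -scaleN1r; exact: Ulin.
have [|p /all_and2[pU pC]] := @choice _ _ (fun v u => U u /\ C (v - u)).
  by move=> v; have [u] := decomp v; exists u.
have p_lin : linear p.
  move=> a u v; apply: (@uniq_dec (a *: u + v)) => //; first exact: Ulin.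
  by rewrite opprD addrACA -scalerBr; exact: Clin.
exists (HB.pack p (GRing.isLinear.Build F V V *:%R p p_lin) : {linear V -> V}).
split=> [v|u Uu] /=; first exact: pU.
by apply: (@uniq_dec u) => //; rewrite subrr.
Qed.

(** Remove the [U]-component, project onto the line through [z], and read off the coefficient of
    [z]. *)
Lemma exists_functional U (x : V) : U 0 -> linear_set U -> ~ U x ->
  exists phi : {linear V -> F^o}, (forall u, U u -> phi u = 0) /\ phi x = 1.
Proof.
move=> U0 Ulin Ux; have [p [pU pK]] := exists_projection U0 Ulin.
pose z := x - p x.
have z0 : z != 0.
  by apply/negP => /eqP/subr0_eq xE; apply: Ux; rewrite xE.
have [||q [qz qK]] := @exists_projection [set v | exists c, v = c *: z].
- by exists 0; rewrite scale0r.
- move=> a _ _ [b ->] [c ->]; exists (a * b + c).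
  by rewrite scalerDl scalerA.
have [c cE] := choice (fun v => qz (v - p v)).
have scalez_inj (a b : F) : a *: z = b *: z -> a = b.
  move/eqP; rewrite -subr_eq0 -scalerBl scaler_eq0 (negPf z0) orbF subr_eq0.
  by move/eqP.
have c_lin : linear (c : V -> F^o).
  move=> a u v; apply: scalez_inj; rewrite scalerDl.
  rewrite -[X in _ = X + _](scalerA a (c u)) -!cE.
  by rewrite -linearP linearP opprD addrACA -scalerBr.
exists (HB.pack (c : V -> F^o)
  (GRing.isLinear.Build F V F^o *:%R (c : V -> F^o) c_lin) : {linear V -> F^o}).
split=> [u Uu|] /=; apply: scalez_inj; rewrite -cE.
  by rewrite pK // subrr linear0 scale0r.
by rewrite qK ?scale1r //; exists 1; rewrite scale1r.
Qed.

End Projections.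

(** * Extending endomorphisms of [W] to [V] *)

Section Extensions.
Variables (F : fieldType) (V : lmodType F) (W : submodClosed V).
Local Open Scope classical_set_scope.
Local Open Scope ring_scope.

Lemma exists_retraction : exists p : {linear V -> subspace W}, cancel val p.
Proof.
have [|a u v uW vW|p [pW pK]] := @exists_projection _ V [set v | v \in W].
- exact: rpred0.
- by rewrite /= rpredD ?rpredZ.
pose r v : subspace W := Sub (p v) (pW v).
have r_lin : linear r.
  by move=> a u v; apply: val_inj; rewrite /= linearP.
exists (HB.pack r (GRing.isLinear.Build F V _ *:%R r r_lin)
  : {linear V -> subspace W}).
by move=> w; apply: val_inj; rewrite /= pK //; exact: valP.
Qed.

Lemma functional_off_subspace (x : V) : x \notin W ->
  exists phi : {linear V -> F^o}, (forall w, w \in W -> phi w = 0) /\ phi x = 1.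
Proof.
move=> xW; apply: exists_functional => [|a u v uW vW|]; first exact: rpred0.
  by rewrite /= rpredD ?rpredZ.
exact/negP.
Qed.

Lemma exists_off_subspace : ~ (W =i predT) -> exists x, x \notin W.
Proof.
move=> properW; apply: contrapT => allW; apply: properW => x.
by apply/negPn/negP => xW; apply: allW; exists x.
Qed.

Section Extend.
Variables (p : {linear V -> subspace W}) (phi : {linear V -> F^o}).
Variables (s : linmap (subspace W)) (y : V).

Definition extend_fun (v : V) : V := val (s (p v)) + (phi v : F) *: y.

Lemma extend_fun_linear : linear extend_fun.
Proof.
move=> a u v; rewrite /extend_fun !linearP /= scalerDl scalerDr -!scalerA.
by rewrite addrACA.
Qed.

HB.instance Definition _ :=
  GRing.isLinear.Build F V V _ extend_fun extend_fun_linear.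

Definition extend : linmap V := extend_fun.

Lemma extendE v : extend v = val (s (p v)) + (phi v : F) *: y.
Proof. by []. Qed.

Hypothesis pK : cancel val p.
Hypothesis phiW : forall w, w \in W -> phi w = 0.

Lemma extend_val (w : subspace W) : extend (val w) = val (s w).
Proof. by rewrite extendE pK phiW ?scale0r ?addr0 //; exact: valP. Qed.

Lemma extend_in (S : set (linmap (subspace W))) :
  S s -> lin_restr_in S extend.
Proof.
move=> Ss; have inv : Defs.invariant W extend.
  by move=> w wW; rewrite (extend_val (Sub w wW)); exact: valP.
exists inv; suff -> : restr inv = s by [].
by apply: linmap_ext => w; apply: val_inj; rewrite /= -extend_val.
Qed.

End Extend.

(** Trades the invariance proof inside [restr] for a pointwise equation. *)
Lemma lin_restr_inP (S : set (linmap (subspace W))) (f : linmap V) :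
  lin_restr_in S f <->
  exists2 s, S s & forall w, f (val w) = val (s w).
Proof.
split=> [[fW Sf]|[s Ss fE]]; first by exists (restr fW).
have fW : Defs.invariant W f.
  by move=> w wW; rewrite (fE (Sub w wW)); exact: valP.
exists fW; suff -> : restr fW = s by [].
by apply: linmap_ext => w; apply: val_inj; rewrite /= fE.
Qed.

Lemma lin_restr_in_subsemigroup (S : set (linmap (subspace W))) :
  subsemigroup S -> subsemigroup (lin_restr_in S).
Proof.
move=> [[s Ss] SM]; have [p pK] := exists_retraction.
(* The values [\0] and 0 switch the rank one term off, leaving [p] followed by [s]. *)
split; first by exists (extend p \0 s 0); exact: extend_in.
move=> f g /lin_restr_inP[s1 Ss1 fE] /lin_restr_inP[s2 Ss2 gE].
apply/lin_restr_inP; exists (s1 * s2)%g; first exact: SM.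
by move=> w /=; rewrite fE gE.
Qed.

End Extensions.

(** * Codimension one without quotients *)

Section Codimension.
Variables (F : fieldType) (V : lmodType F) (W : submodClosed V).
Local Open Scope ring_scope.
Local Open Scope quotient_scope.

Lemma eq_pi_quotient (u v : V) :
  \pi_(quotient W) u = \pi_(quotient W) v <-> u - v \in W.
Proof.
have -> : (u - v \in W) = (\pi_(quotient W) u == \pi_(quotient W) v).
  exact: (Quotient.idealrBE (subspace_pred W)).
by split=> [->|/eqP].
Qed.

Lemma scale_pi_quotient (a : F) (v : V) :
  a *: \pi_(quotient W) v = \pi_(quotient W) (a *: v).
Proof. exact: pi_quotient_scale. Qed.

Lemma pi_quotient0 : \pi_(quotient W) 0 = 0.
Proof. by rewrite -(scale0r 0) -scale_pi_quotient scale0r. Qed.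

Lemma codim_eq1P :
  codim_eq W 1 <->
  exists2 x, x \notin W & forall y, exists c : F, y - c *: x \in W.
Proof.
split=> [[b [bfree bspan]]|[x xW Wx]].
  have [x bE] : exists x, b ord0 = \pi_(quotient W) x.
    by exists (repr (b ord0)); rewrite reprK.
  exists x => [|y].
    apply/negP => xW; apply: (elimN eqP (oner_neq0 F)).
    apply: (bfree (fun=> 1) _ ord0).
    rewrite big_ord1 scale1r bE -pi_quotient0.
    by apply/eq_pi_quotient; rewrite subr0.
  have [c] := bspan (\pi_(quotient W) y).
  rewrite big_ord1 bE scale_pi_quotient => /eq_pi_quotient.
  by exists (c ord0).
exists (fun=> \pi_(quotient W) x); split=> [c|u].
  rewrite big_ord1 scale_pi_quotient -pi_quotient0 => /eq_pi_quotient.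
  rewrite subr0 => cxW i; rewrite ord1; apply/eqP/negPn/negP => c0.
  by case/negP: xW; rewrite -(scalerK c0 x) rpredZ.
have [c cW] := Wx (repr u); exists (fun=> c).
by rewrite big_ord1 -[u]reprK scale_pi_quotient; apply/eq_pi_quotient.
Qed.

End Codimension.

(** * Complete regularity of [S] and of [lin_restr_in S] *)

Section CompletelyRegularExtensions.
Variables (F : fieldType) (V : lmodType F) (W : submodClosed V).
Variable S : set (linmap (subspace W)).
Hypothesis S_sub : subsemigroup S.
Local Open Scope classical_set_scope.
Local Open Scope ring_scope.

Lemma completely_regular_linmapP (U : lmodType F) (A : set (linmap U)) :
  completely_regular_semigroup A <->
  subsemigroup A /\
  forall f, A f -> exists2 g, A g &
    (forall v, f (g v) = g (f v)) /\ (forall v, f (g (f v)) = f v).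
Proof.
rewrite completely_regularP; split=> -[Asub crA];
  split=> // f /crA[g Ag [fg fgf]].
  exists g => //; split=> v.
    by have /(congr1 (fun h : linmap U => h v)) := fg.
  by have /(congr1 (fun h : linmap U => h v)) := fgf.
by exists g => //; split; apply: linmap_ext => v /=.
Qed.

(** A commuting inverse of an extension of [s] restricts on [W] to a commuting inverse of [s] in
    [S]. *)
Lemma completely_regular_restr :
  completely_regular_semigroup (lin_restr_in S) ->
  completely_regular_semigroup S.
Proof.
move=> /completely_regular_linmapP[_ crT]; apply/completely_regular_linmapP.
split=> // s Ss; have [p pK] := exists_retraction W.
have sE := extend_val s 0 pK (phi := \0) (fun _ _ => erefl).
have [|g /lin_restr_inP[t St gE] [fg fgf]] := crT (extend p \0 s 0).
  exact: extend_in.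
exists t => //; split=> w; apply: val_inj.
  by rewrite -sE -!gE fg sE.
by rewrite -!sE -gE -sE fgf.
Qed.

(** * Necessity of the conditions for proper [W] *)

Section Forward.
Hypothesis crT : completely_regular_semigroup (lin_restr_in S).

(** With [g] a commuting inverse of [f], [f v = f (g (f v)) = g (f (f v))]. *)
Lemma kernel_square_lin_restr f v : lin_restr_in S f -> f (f v) = 0 -> f v = 0.
Proof.
move=> Tf ffv0.
have [_ /(_ _ Tf)[g _ [fg fgf]]] := (completely_regular_linmapP _).1 crT.
by rewrite -fgf fg ffv0 linear0.
Qed.

Lemma image_square_lin_restr f v :
  lin_restr_in S f -> exists u, f v = f (f u).
Proof.
move=> Tf.
have [_ /(_ _ Tf)[g _ [fg fgf]]] := (completely_regular_linmapP _).1 crT.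
by exists (g v); rewrite -fgf fg fg.
Qed.

(* Perturbing an extension of [s] by a rank one map with values in [W] gives
   maps that send [x] to any prescribed vector of [W], while mapping [V] to
   [W]: comparing with their squares shows that [s] is bijective. *)
Lemma proper_linAut : ~ (W =i predT) -> S `<=` linAut (subspace W).
Proof.
move=> properW s Ss; have [p pK] := exists_retraction W.
have [x xW] := exists_off_subspace properW.
have [phi [phiW phix]] := functional_off_subspace xW.
(* Removing the [W]-component of [x] makes [extend p phi s y] send [x'] exactly to [y]. *)
pose x' := x - val (p x).
have px' : p x' = 0 by rewrite linearB pK subrr.
have phix' : phi x' = 1 by rewrite linearB /= phix phiW ?subr0 //; exact: valP.
have fP (w : subspace W) : let f := extend p phi s (val w) in
    [/\ lin_restr_in S f, f x' = val w, forall w', f (val w') = val (s w')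
      & forall v, f v = val (s (p v) + (phi v : F) *: w)].
  split=> [||w'|v].
  - exact: extend_in.
  - by rewrite extendE px' linear0 phix' scale1r add0r.
  - exact: extend_val.
  - by [].
suff /choice[t tP] : forall w, exists u, s u = w.
  have s_inj : injective s.
    move=> w w' sww'; apply/subr0_eq.
    (* Here [f x' = w - w'] and [f (f x') = s (w - w') = 0], so the kernel condition gives
       [w = w']. *)
    have [Tf fx fW _] := fP (w - w').
    apply: val_inj; rewrite -fx; apply: kernel_square_lin_restr Tf _.
    by rewrite fx fW linearB /= sww' subrr.
  by exists t => // w; apply: s_inj; rewrite tP.
(* Surjectivity: [w = f x'] equals some [f (f u)], and [f u] lies in [W], where [f] is [s]. *)
move=> w; have [Tf fx fW fE] := fP w.
have [u] := image_square_lin_restr x' Tf.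
rewrite fx (fE u) fW => /val_inj ->.
by exists (s (p u) + (phi u : F) *: w).
Qed.

Lemma proper_codim1 : ~ (W =i predT) -> codim_eq W 1.
Proof.
move=> properW; apply/codim_eq1P; have [p pK] := exists_retraction W.
have [x xW] := exists_off_subspace properW.
exists x => // y; apply: contrapT => yWx.
(* [phi] vanishes on [W + F x], so the square of the map [f] below kills [y']
   although [f y' = x'] is nonzero. *)
pose U := [set v | exists c : F, v - c *: x \in W].
have WU w : w \in W -> U w by exists 0; rewrite scale0r subr0.
have [|a u v [c cW] [d dW]|//|phi [phiU phiy]] := @exists_functional _ _ U y.
- by apply: WU; exact: rpred0.
- exists (a * c + d); rewrite scalerDl opprD addrACA -scalerA -scalerBr.
  by rewrite rpredD ?rpredZ.
have [s Ss] := S_sub.1.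
pose x' := x - val (p x); pose y' := y - val (p y).
have px' : p x' = 0 by rewrite linearB pK subrr.
have py' : p y' = 0 by rewrite linearB pK subrr.
have phiW w : w \in W -> phi w = 0 by move/WU; exact: phiU.
have phix : phi x = 0 by apply: phiU; exists 1; rewrite scale1r subrr rpred0.
have phix' : phi x' = 0 by rewrite linearB /= phix phiW ?subr0 //; exact: valP.
have phiy' : phi y' = 1 by rewrite linearB /= phiy phiW ?subr0 //; exact: valP.
pose f := extend p phi s x'.
have fy : f y' = x' by rewrite extendE py' linear0 phiy' scale1r add0r.
have fx : f x' = 0 by rewrite extendE px' linear0 phix' scale0r add0r.
have Tf : lin_restr_in S f by exact: extend_in.
(* The kernel condition forces [x' = 0], which would put [x = val (p x)] in [W]. *)
have := kernel_square_lin_restr Tf (v := y'); rewrite fy => /(_ fx) /subr0_eq xE.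
by move/negP: xW; rewrite xE; apply; exact: valP.
Qed.

End Forward.

(** Injectivity of [s] cancels the outer [s] in [s (t (s u)) = s u]; commutation gives the other
    side. *)
Lemma cancel_commuting_inverse (U : lmodType F) (s t : linmap U) :
  bijective s -> (forall u, s (t u) = t (s u)) ->
  (forall u, s (t (s u)) = s u) -> cancel s t /\ cancel t s.
Proof.
move=> s_bij st sts; have stK : cancel s t.
  by move=> u; apply: (bij_inj s_bij); rewrite sts.
by split=> // u; rewrite st stK.
Qed.

Lemma completely_regular_linAut_subgroup :
  completely_regular_semigroup S -> S `<=` linAut (subspace W) ->
  subgroup_of S (linAut (subspace W)).
Proof.
move=> /completely_regular_linmapP[_ crS] S_aut; split=> //; split=> //.
have invS s : S s -> exists2 t, S t & cancel s t /\ cancel t s.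
  move=> Ss; have [t St [st sts]] := crS _ Ss.
  by exists t => //; apply: cancel_commuting_inverse => //; exact: S_aut.
have [s Ss] := S_sub.1; have [t St [stK tsK]] := invS _ Ss.
(* The identity map is reached inside [S] as a product of mutually inverse elements. *)
exists (s * t)%g; first exact: S_sub.2.
split=> [r Sr|r Sr]; first by split; apply: linmap_ext => w /=; rewrite stK.
have [q Sq [rqK qrK]] := invS _ Sr.
by exists q => //; split; apply: linmap_ext => w /=; rewrite stK ?rqK ?qrK.
Qed.

(** * Sufficiency of the conditions *)

Lemma completely_regular_extension_full :
  completely_regular_semigroup S -> W =i predT ->
  completely_regular_semigroup (lin_restr_in S).
Proof.
move=> /completely_regular_linmapP[_ crS] WT; apply/completely_regular_linmapP.
split; first exact: lin_restr_in_subsemigroup.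
move=> f /lin_restr_inP[s Ss fE]; have [t St [st sts]] := crS _ Ss.
have [p pK] := exists_retraction W.
have tE := extend_val t 0 pK (phi := \0) (fun _ _ => erefl).
exists (extend p \0 t 0); first exact: extend_in.
have vE v : exists w : subspace W, v = val w.
  have vW : v \in W by rewrite WT.
  by exists (Sub v vW).
by split=> v; have [w ->] := vE v; rewrite !(fE, tE) ?sts ?st.
Qed.

Lemma completely_regular_extension_codim1 :
  codim_eq W 1 -> completely_regular_semigroup S ->
  S `<=` linAut (subspace W) ->
  completely_regular_semigroup (lin_restr_in S).
Proof.
move=> /codim_eq1P[x0 x0W Wx0] /completely_regular_linmapP[_ crS] S_aut.
apply/completely_regular_linmapP.
split; first exact: lin_restr_in_subsemigroup.
have [p pK] := exists_retraction W.
have [phi [phiW phix0]] := functional_off_subspace x0W.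
pose x := x0 - val (p x0).
have px : p x = 0 by rewrite linearB pK subrr.
have phix : phi x = 1 by rewrite linearB /= phix0 phiW ?subr0 //; exact: valP.
have decomp v : v = val (p v) + (phi v : F) *: x.
  (* Passing from [x0] to [x] shifts the [W]-component by [c *: p x0]. *)
  have [c cW] := Wx0 v; pose w : subspace W :=
    (Sub (v - c *: x0) cW : subspace W) + c *: p x0.
  have vE : v = val w + c *: x.
    have -> : val w = v - c *: x0 + c *: val (p x0) by [].
    by rewrite /x scalerBr addrACA subrK subrr addr0.
  have pv : p v = w by rewrite vE linearD pK linearZ /= px scaler0 addr0.
  have phiv : phi v = c.
    rewrite vE linearD (phiW _ (valP w)) add0r linearZ phix.
    exact: mulr1.
  by rewrite pv phiv.
move=> f /lin_restr_inP[s Ss fE].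
have [t St [st sts]] := crS _ Ss.
have [stK tsK] := cancel_commuting_inverse (S_aut _ Ss) st sts.
pose w0 := p (f x); pose a : F := phi (f x).
have fxE : f x = val w0 + a *: x by exact: decomp.
have fvE v : f v = val (s (p v)) + (phi v : F) *: f x.
  by rewrite {1}(decomp v) linearD /= fE linearZ.
have [a0|a0] := eqVneq a 0.
  have tE := extend_val t 0 pK (phi := \0) (fun _ _ => erefl).
  have Te : lin_restr_in S (extend p \0 t 0) by exact: extend_in.
  have TM := (lin_restr_in_subsemigroup S_sub).2.
  (* Here [f] maps into [W]. On [W] this product is [t], the inverse of [s]: the second copy of [t]
     compensates for the leading [f], which makes the values lie in [W]. *)
  exists (f * extend p \0 t 0 * extend p \0 t 0)%g.
    by apply: (TM _ _ (TM _ _ _ Te) Te); apply/lin_restr_inP; exists s.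
  have fvW v : exists u : subspace W, f v = val u.
    exists (s (p v) + (phi v : F) *: w0).
    by rewrite fvE fxE a0 scale0r addr0.
  by split=> v /=; have [u ->] := fvW v; rewrite !(fE, tE) !(stK, tsK).
(* This [y] solves [f y = x], since [f x - val w0 = a *: x] and [s (t w0) = w0]; [f] is then
   invertible, its inverse extending [t] and sending [x] to [y]. *)
pose y := a^-1 *: (x - val (t w0)).
exists (extend p phi t y); first exact: extend_in.
have fyE : f y = x.
  rewrite /y linearZ /= linearB /= fE tsK fxE addrAC subrr add0r.
  by rewrite scalerK.
have fgK v : f (extend p phi t y v) = v.
  by rewrite extendE linearD /= fE tsK linearZ /= fyE -decomp.
split=> v; last by rewrite fgK.
rewrite fgK fvE linearD /= extend_val // stK linearZ /= extendE -/w0 -/a.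
by rewrite /y scalerA mulfV // scale1r addrCA subrr addr0 -decomp.
Qed.

End CompletelyRegularExtensions.

Theorem theorem4p11 (F : fieldType) (V : lmodType F) (W : submodClosed V)
    (SW : set (linmap (subspace W))) (hSW : subsemigroup SW) :
  completely_regular_semigroup (lin_restr_in SW) <->
  completely_regular_semigroup SW /\
  (W =i predT \/
   codim_eq W 1 /\ subgroup_of SW (linAut (subspace W))).
Proof.
split=> [crT|[crS [WT|[codimW [SW_aut _]]]]].
- have crS := completely_regular_restr hSW crT; split=> //.
  have [WT|properW] := pselect (W =i predT); [by left|right].
  split; first exact: proper_codim1 crT properW.
  by apply: completely_regular_linAut_subgroup => //; exact: proper_linAut.
- exact: completely_regular_extension_full.
- exact: completely_regular_extension_codim1.
Qed.
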